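(* Let $A$ be a unital Arens-regular Banach *-algebra that is densely embedded as a differential subalgebra of $C(X)$ for some compact space $X$. Then $A^{**}$ has open multiplication at all pairs of jointly non-degenerate elements.
   Context: All Banach algebras are over $\mathbb C$; compact spaces are Hausdorff; homomorphisms between unital Banach algebras preserve the unit. Arens products: for a Banach algebra $A$ and $f,g\in A^{**}$, choose bounded nets $(f_j)$, $(g_i)$ in $A$ weak*-convergent to $f$ and $g$. The left and right Arens products are $f\,\square\, g=\lim_j\lim_i f_jg_i$ and $f\diamond g=\lim_i\lim_j f_jg_i$ (weak* limits; independent of the nets). $A$ is Arens-regular if the two products coincide; then $A^{**}$ is a Banach algebra with this unique Arens product. When $A$ is an Arens-regular Banach *-algebra, $A^{**}$ carries the involution extending that of $A$ (the weak*-continuous extension). Differential subalgebra: given a unital injective homomorphism $i\colon A\to B$ of unital Banach algebras, $A$ is a differential subalgebra of $B$ if there is $D>0$ such that $\|ab\|_A\leqslant D(\|a\|_A\|i(b)\|_B+\|i(a)\|_B\|b\|_A)$ for all $a,b\in A$; when $A$ and $B$ are Banach *-algebras, $i$ is additionally required to be *-preserving. ''Densely embedded'' means that $i(A)$ is dense in $C(X)$. Elements $a,b$ of a unital Banach *-algebra are jointly non-degenerate if $|a|^2+|b|^2$ is invertible, where $|a|^2=a^*a$. Multiplication in a Banach algebra $M$ is open at a pair $(F,G)\in M\times M$ if for every $\varepsilon>0$ there is $\delta>0$ with $B_M(FG,\delta)\subseteq B_M(F,\varepsilon)\cdot B_M(G,\varepsilon)$. *)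

(* Defs.v *)
From HB Require Import structures.
From mathcomp Require Import all_boot all_order all_algebra.
From mathcomp Require Import complex.
From mathcomp Require Import all_classical all_reals topology normedtype.

Set Implicit Arguments.
Unset Strict Implicit.
Unset Printing Implicit Defensive.
Import Order.TTheory GRing.Theory Num.Theory.
Import numFieldNormedType.Exports.

Local Open Scope classical_set_scope.
Local Open Scope complex_scope.
Local Open Scope ring_scope.

(* The complex field is R[i] for R : realType, and norms of R[i]-modules take  *)
(* their values in R[i].  As x <= y in R[i] forces Im x = Im y, the hypothesis *)
(* 0 < e for e : R[i] says that e is a positive real number.                   *)

#[warnings="-redundant-canonical-projection"]
HB.instance Definition _ (R : realType) := NormedModule.copy R[i] R[i]^o.

Section ComplexComplete.
Context {R : realType}.

Lemma complex_complete (F : set_system R[i]) :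
  ProperFilter F -> cauchy F -> cvg F.
Proof.
move=> FF /cauchy_ballP Fc.
have Pc (f : R[i] -> R) : (forall x y, `|f x - f y|%:C <= `|x - y|) ->
    cvg (f @ F).
  move=> fE; apply/cauchy_cvgP/cauchy_ballP => e e0; rewrite near_map2.
  have e0' : 0 < e%:C by rewrite ltcR.
  apply: filterS (Fc _ e0') => -[x y]; rewrite -!ball_normE /ball_/= => xy.
  by rewrite -ltcR (le_lt_trans _ xy).
have ReF : cvg ((fun z : R[i] => complex.Re z) @ F).
  apply: Pc => x y; apply: le_trans (normc_ge_Re (x - y)).
  by case: x y => [? ?] [? ?].
have ImF : cvg ((fun z : R[i] => complex.Im z) @ F).
  apply: Pc => -[x1 x2] [y1 y2]; rewrite [leRHS]normc_def lecR -sqrtr_sqr.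
  by rewrite ler_wsqrtr//= lerDr sqr_ge0.
move: ReF ImF => /cvg_ex[/= a aF] /cvg_ex[/= b bF].
apply/cvg_ex; exists (a +i* b); apply/cvgrPdist_lt => e e0.
have [r r0 ->] : exists2 r : R, 0 < r & e = r%:C.
  by exists (complex.Re e); rewrite -?ltcR RRe_real// gtr0_real.
have r2 : 0 < r / 2 by rewrite divr_gt0.
move/cvgrPdist_lt: aF => /(_ _ r2); move/cvgrPdist_lt: bF => /(_ _ r2).
apply: filterS2 => -[x y] /= yb xa.
have -> : a +i* b - (x +i* y) = (a - x)%:C + 'i * (b - y)%:C.
  by rewrite [LHS]complexE.
rewrite (le_lt_trans (ler_normD _ _))// normrM.
have -> : `|'i| = 1 :> R[i].
  by rewrite normc_def/= expr0n expr1n add0r sqrtr1.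
rewrite mul1r !normc_def/= expr0n !addr0 !sqrtr_sqr -rmorphD ltcR.
by rewrite (splitr r) ltrD.
Qed.

HB.instance Definition _ := Uniform_isComplete.Build R[i] complex_complete.

Definition rnorm (V : normedModType R[i]) (x : V) : R := complex.Re `|x|.

Lemma rnormE (V : normedModType R[i]) (x : V) : (rnorm x)%:C = `|x|.
Proof. by rewrite /rnorm RRe_real// normr_real. Qed.

Lemma rnorm_dist (V : normedModType R[i]) (x y : V) :
  `|rnorm x - rnorm y|%:C <= `|x - y|.
Proof.
apply: le_trans (ler_dist_dist x y).
rewrite -(rnormE x) -(rnormE y) -rmorphB normc_def/= expr0n addr0.
by rewrite sqrtr_sqr.
Qed.

End ComplexComplete.

(* HB rejects a common extension of pzRingType and normedModType (it would     *)
(* need a join below numDomainType), hence a product of our own.               *)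
HB.mixin Record isBanachAlgebra (R : realType) A
    & CompleteNormedModule R[i] A := {
  bone : A ;
  bmul : A -> A -> A ;
  bmulA : associative bmul ;
  bmul1l : left_id bone bmul ;
  bmul1r : right_id bone bmul ;
  bmulDl : left_distributive bmul +%R ;
  bmulDr : right_distributive bmul +%R ;
  bmulZl : forall (k : R[i]) (a b : A), bmul (k *: a) b = k *: bmul a b ;
  bmulZr : forall (k : R[i]) (a b : A), bmul a (k *: b) = k *: bmul a b ;
  bnormM : forall a b : A, `|bmul a b| <= `|a| * `|b|
}.

#[short(type="banachAlgType")]
HB.structure Definition BanachAlgebra (R : realType) :=
  {A of isBanachAlgebra R A & CompleteNormedModule R[i] A}.

Arguments bone {R} s.

Declare Scope banach_scope.
Delimit Scope banach_scope with B.
Notation "a ** b" := (bmul a b) (at level 40, left associativity) :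
  banach_scope.
Local Open Scope banach_scope.

HB.mixin Record isBanachStarAlgebra (R : realType) A & BanachAlgebra R A := {
  star : A -> A ;
  starD : forall a b, star (a + b) = star a + star b ;
  starZ : forall (k : R[i]) a, star (k *: a) = conjc k *: star a ;
  starM : forall a b : A, star (a ** b) = star b ** star a ;
  starK : involutive star ;
  star_continuous : continuous star
}.

#[short(type="banachStarAlgType")]
HB.structure Definition BanachStarAlgebra (R : realType) :=
  {A of isBanachStarAlgebra R A & BanachAlgebra R A}.

Section ContinuousFunctions.
Context {R : realType} {X : topologicalType}.
Implicit Types cX : compact [set: X].

Definition contfun_pred : {pred X -> R[i]} :=
  [pred f | `[< continuous (f : X -> R[i]) >]].

(* C(X): the compactness proof is a parameter so that the sup norm is a norm. *)
Record contfun cX :=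
  ContFun { contfun_val :> X -> R[i] ; _ : contfun_val \in contfun_pred }.

HB.instance Definition _ cX := [isSub for @contfun_val cX].
HB.instance Definition _ cX := [Choice of contfun cX by <:].

Lemma contfun_cts cX (f : contfun cX) : continuous f.
Proof. by case: f => f /= /asboolP. Qed.

Lemma contfun_submod : submod_closed contfun_pred.
Proof.
split; first by apply/asboolP => x; exact: cvg_cst.
move=> k f g /asboolP cf /asboolP cg; apply/asboolP => x.
by apply: cvgD; [apply: cvgZr; exact: cf|exact: cg].
Qed.
HB.instance Definition _ := GRing.isSubmodClosed.Build R[i] (X -> R[i])
  contfun_pred contfun_submod.
HB.instance Definition _ cX := [SubChoice_isSubZmodule of contfun cX by <:].
HB.instance Definition _ cX := [SubZmodule_isSubLmodule of contfun cX by <:].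

Section Norm.
Variable cX : compact [set: X].
Implicit Types f g h : contfun cX.

Definition supnorm f : R[i] := (sup (range (fun x => rnorm (f x))))%:C.

Lemma contfun_bounded f : has_ubound (range (fun x => rnorm (f x))).
Proof.
have cf : continuous (fun x => rnorm (f x)).
  move=> x; apply/cvgrPdist_lt => e e0.
  have e0' : 0 < e%:C by rewrite ltcR.
  have /cvgrPdist_lt/(_ _ e0') := @contfun_cts cX f x.
  apply: filterS => y; rewrite -[ltRHS]/(e%:C) -ltcR; apply: le_lt_trans.
  exact: rnorm_dist.
have := continuous_compact (continuous_subspaceT cf) cX.
move=> /compact_bounded/pinfty_ex_gt0[M M0 fM]; exists M => _ [x _ <-].
by rewrite (le_trans (ler_norm _))//; apply: fM; exists x.
Qed.

Lemma le_supnorm f x : `|f x| <= supnorm f.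
Proof.
rewrite -rnormE lecR; apply: ub_le_sup; first exact: contfun_bounded.
by exists x.
Qed.

Lemma supnorm_le f (M : R[i]) : 0 <= M -> (forall x, `|f x| <= M) ->
  supnorm f <= M.
Proof.
move=> M0 fM; rewrite -(RRe_real (ger0_real M0)) lecR.
have [[x0 _]|/nonemptyPn T0] := pselect ([set: X] !=set0).
  apply: ge_sup; first by exists (rnorm (f x0)), x0.
  by move=> _ [x _ <-]; rewrite -lecR rnormE RRe_real// ger0_real.
by rewrite T0 image_set0 sup0 -lecR RRe_real// ger0_real.
Qed.

Lemma supnorm_ge0 f : 0 <= supnorm f.
Proof.
have [[x0 _]|/nonemptyPn T0] := pselect ([set: X] !=set0).
  exact: le_trans (normr_ge0 _) (le_supnorm f x0).
by rewrite /supnorm T0 image_set0 sup0.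
Qed.

Lemma supnormD f g : supnorm (f + g) <= supnorm f + supnorm g.
Proof.
apply: supnorm_le => [|x]; first by rewrite addr_ge0// supnorm_ge0.
by rewrite (le_trans (ler_normD _ _))// lerD// le_supnorm.
Qed.

Lemma supnormZ (k : R[i]) f : supnorm (k *: f) = `|k| * supnorm f.
Proof.
have leZ (l : R[i]) g : supnorm (l *: g) <= `|l| * supnorm g.
  apply: supnorm_le => [|x]; first by rewrite mulr_ge0// supnorm_ge0.
  by rewrite [leLHS]normrM ler_wpM2l// le_supnorm.
have [->|k0] := eqVneq k 0.
  rewrite scale0r normr0 mul0r; apply/le_anti; rewrite supnorm_ge0 andbT.
  by apply: supnorm_le => // x; rewrite normr0.
apply/le_anti; rewrite leZ/= -ler_pdivlMl ?normr_gt0// -normfV.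
by rewrite -[X in supnorm X <= _](scalerK k0) leZ.
Qed.

Lemma supnorm_eq0 f : supnorm f = 0 -> f = 0.
Proof.
move=> f0; apply/val_inj/funext => x; apply/eqP.
by rewrite -normr_le0 -f0 le_supnorm.
Qed.

HB.instance Definition _ := Lmodule_isNormed.Build R[i] (contfun cX)
  supnormD supnormZ supnorm_eq0.

Lemma contfun_complete (F : set_system (contfun cX)) :
  ProperFilter F -> cauchy F -> cvg F.
Proof.
move=> FF /cauchy_ballP Fc.
have ptc x : cvg ((fun f : contfun cX => f x) @ F).
  apply/cauchy_cvgP/cauchy_ballP => e e0; rewrite near_map2.
  apply: filterS (Fc _ e0) => -[f g]; rewrite -!ball_normE /ball_/=.
  exact: le_lt_trans (le_supnorm (f - g) x).
pose l x := lim ((fun f : contfun cX => f x) @ F).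
have unif (e : R[i]) : 0 < e ->
    \forall f \near F, forall x, `|l x - (f : contfun cX) x| <= e.
  move=> e0; have e2 : 0 < e / 2 by rewrite divr_gt0.
  have /nearP_dep Fe := Fc _ e2.
  apply: filterS Fe => f Ff x.
  have /cvgrPdist_lt/(_ _ e2) Flx : (fun g : contfun cX => g x) @ F --> l x.
    exact: ptc.
  have [g [/= lg fg]] := filter_ex (filterI Flx Ff).
  rewrite (le_trans (ler_distD (g x) _ _))// (splitr e) lerD ?ltW//.
  rewrite distrC; move: fg; rewrite -ball_normE; apply: le_lt_trans.
  exact: (le_supnorm (f - g) x).
have lc : continuous l.
  move=> x; apply/cvgrPdist_lt => e e0.
  have e4 : 0 < e / 2 / 2 by rewrite !divr_gt0.
  have /filter_ex[f fe] := unif _ e4.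
  have e2 : 0 < e / 2 by rewrite divr_gt0.
  have /cvgrPdist_lt/(_ _ e2) := @contfun_cts cX f x.
  apply: filterS => y fxy.
  have -> : l x - l y = (f x - f y) + ((l x - f x) + (f y - l y)).
    by rewrite [l x - _ + _]addrC addrA [_ + (f y - _)]addrA subrK addrC subrKA.
  rewrite (le_lt_trans (ler_normD _ _))// (splitr e) ltr_leD//.
  rewrite (le_trans (ler_normD _ _))// (splitr (e / 2)) lerD//.
  by rewrite distrC.
apply/cvg_ex.
exists (@ContFun cX l (asboolT lc)); apply/cvgrPdist_le => e e0.
apply: filterS (unif _ e0) => f fe.
by apply: supnorm_le => //; exact: ltW.
Qed.

HB.instance Definition _ :=
  Uniform_isComplete.Build (contfun cX) contfun_complete.

Lemma contfun_one_subproof : (fun=> 1 : R[i]) \in contfun_pred.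
Proof. by apply/asboolP => x; exact: cvg_cst. Qed.

Definition contfun_one : contfun cX := ContFun cX contfun_one_subproof.

Lemma contfun_mul_subproof f g : (fun x => f x * g x) \in contfun_pred.
Proof. by apply/asboolP => x; apply: cvgM; exact: contfun_cts. Qed.

Definition contfun_mul f g : contfun cX :=
  ContFun cX (contfun_mul_subproof f g).

Lemma contfun_conj_subproof f : (fun x => conjc (f x)) \in contfun_pred.
Proof.
apply/asboolP => x; apply/cvgrPdist_lt => e e0.
have /cvgrPdist_lt/(_ _ e0) := @contfun_cts cX f x.
by apply: filterS => y; rewrite -rmorphB normcJ.
Qed.

Definition contfun_conj f : contfun cX := ContFun cX (contfun_conj_subproof f).

Lemma contfunP f g : (forall x, f x = g x) -> f = g.
Proof. by move=> fg; apply/val_inj/funext. Qed.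

Let mulA : associative contfun_mul.
Proof. by move=> f g h; apply: contfunP => x; rewrite /= mulrA. Qed.
Let mul1 : left_id contfun_one contfun_mul.
Proof. by move=> f; apply: contfunP => x; rewrite /= mul1r. Qed.
Let mulr1 : right_id contfun_one contfun_mul.
Proof. by move=> f; apply: contfunP => x; rewrite /= mulr1. Qed.
Let mulDl : left_distributive contfun_mul +%R.
Proof. by move=> f g h; apply: contfunP => x; exact: mulrDl. Qed.
Let mulDr : right_distributive contfun_mul +%R.
Proof. by move=> f g h; apply: contfunP => x; exact: mulrDr. Qed.
Let mulZl (k : R[i]) f g : contfun_mul (k *: f) g = k *: contfun_mul f g.
Proof. by apply: contfunP => x; rewrite /= -[LHS]mulrA. Qed.
Let mulZr (k : R[i]) f g : contfun_mul f (k *: g) = k *: contfun_mul f g.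
Proof. by apply: contfunP => x; exact: mulrCA. Qed.
Let normM f g : `|contfun_mul f g| <= `|f| * `|g|.
Proof.
apply: supnorm_le => [|x]; first by rewrite mulr_ge0.
by rewrite normrM ler_pM// le_supnorm.
Qed.

HB.instance Definition _ := isBanachAlgebra.Build R (contfun cX)
  mulA mul1 mulr1 mulDl mulDr mulZl mulZr normM.

Let conjD f g : contfun_conj (f + g) = contfun_conj f + contfun_conj g.
Proof. by apply: contfunP => x; exact: rmorphD. Qed.
Let conjZ (k : R[i]) f : contfun_conj (k *: f) = conjc k *: contfun_conj f.
Proof. by apply: contfunP => x; exact: rmorphM. Qed.
Let conjM f g :
  contfun_conj (f ** g) = contfun_conj g ** contfun_conj f.
Proof. by apply: contfunP => x; rewrite /= mulrC -rmorphM. Qed.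
Let conjK : involutive contfun_conj.
Proof. by move=> f; apply: contfunP => x; exact: conjcK. Qed.
Let conj_cts : continuous contfun_conj.
Proof.
move=> f; apply/(@cvgrPdist_le _ _ _ (nbhs f)) => e e0; near=> g.
apply: supnorm_le => [|x]; first exact: ltW.
rewrite [X in `|X|](_ : _ = conjc (f x - g x)); last by rewrite rmorphB.
rewrite normcJ (le_trans (le_supnorm (f - g) x))//.
near: g; suff /(@cvgrPdist_le _ _ _ (nbhs f)) : id @ nbhs f --> f by exact.
exact: cvg_id.
Unshelve. all: by end_near. Qed.

HB.instance Definition _ := isBanachStarAlgebra.Build R (contfun cX)
  conjD conjZ conjM conjK conj_cts.

End Norm.
End ContinuousFunctions.

Arguments contfun R {X} cX.

Section Dual.
Context {R : realType}.

Definition dual_pred (V : normedModType R[i]) : {pred V -> R[i]} :=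
  [pred f | `[< linear (f : V -> R[i]) /\ continuous (f : V -> R[i]) >]].
Arguments dual_pred : clear implicits.

Record dual (V : normedModType R[i]) :=
  Dual { dual_val :> V -> R[i] ; _ : dual_val \in dual_pred V }.

HB.instance Definition _ V := [isSub for @dual_val V].
HB.instance Definition _ V := [Choice of dual V by <:].

Section DualTheory.
Variable V : normedModType R[i].
Implicit Types (f g : dual V) (k : R[i]) (x y : V).

Lemma dual_linear f : linear f.
Proof. by case: f => f /= /asboolP[]. Qed.

Lemma dual_cts f : continuous f.
Proof. by case: f => f /= /asboolP[]. Qed.

Lemma dualP f g : (forall x, f x = g x) -> f = g.
Proof. by move=> fg; apply/val_inj/funext. Qed.

Lemma dualD f x y : f (x + y) = f x + f y.
Proof. by have := dual_linear f 1 x y; rewrite !scale1r. Qed.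

Lemma dual0 f : f 0 = 0.
Proof. by apply: (addrI (f 0)); rewrite -dualD !addr0. Qed.

Lemma dualZ f k x : f (k *: x) = k * f x.
Proof. by have := dual_linear f k x 0; rewrite dual0 !addr0. Qed.

Lemma dual_bounded f : exists2 M : R[i], 0 <= M & forall x, `|f x| <= M * `|x|.
Proof.
pose F := GRing.isLinear.Build R[i] V R[i] *:%R f (dual_linear f).
pose f' : {linear V -> R[i]} := HB.pack (f : V -> R[i]) F.
have /linear_bounded_continuous/linear_boundedP : continuous f' := @dual_cts f.
by move=> /pinfty_ex_gt0[M M0 fM]; exists M => //; exact: ltW.
Qed.

Lemma dual_submod : submod_closed (dual_pred V).
Proof.
split.
  by apply/asboolP; split=> [k x y|x]; [rewrite scaler0 addr0|exact: cvg_cst].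
move=> k f g /asboolP[lf cf] /asboolP[lg cg]; apply/asboolP; split=> [l x y|x].
  rewrite -[LHS]/(k * f (l *: x + y) + g (l *: x + y)) lf lg.
  rewrite -[RHS]/(l * (k * f x + g x) + (k * f y + g y)).
  by rewrite -![_ *: _]/(_ * _) !mulrDr addrACA mulrCA.
by apply: cvgD; [apply: cvgZr; exact: cf|exact: cg].
Qed.
End DualTheory.

HB.instance Definition _ (V : normedModType R[i]) :=
  GRing.isSubmodClosed.Build R[i] (V -> R[i]) (dual_pred V) (dual_submod V).
HB.instance Definition _ (V : normedModType R[i]) :=
  [SubChoice_isSubZmodule of dual V by <:].
HB.instance Definition _ (V : normedModType R[i]) :=
  [SubZmodule_isSubLmodule of dual V by <:].

Section OperatorNorm.
Variable V : normedModType R[i].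
Implicit Types (f g : dual V) (k : R[i]) (x y : V).

Definition opnorm f : R[i] :=
  (sup [set rnorm (f x) | x in [set x : V | `|x| <= 1]])%:C.

Lemma le_opnorm1 f x : `|x| <= 1 -> `|f x| <= opnorm f.
Proof.
move=> x1; rewrite -rnormE lecR; apply: ub_le_sup; last by exists x.
have [M M0 fM] := dual_bounded f; exists (complex.Re M) => _ [y /= y1 <-].
rewrite -lecR rnormE RRe_real ?ger0_real// (le_trans (fM y))//.
by rewrite ler_piMr.
Qed.

Lemma opnorm_ge0 f : 0 <= opnorm f.
Proof. by rewrite (le_trans (normr_ge0 (f 0)))// le_opnorm1// normr0. Qed.

Lemma le_opnorm f x : `|f x| <= opnorm f * `|x|.
Proof.
have [->|x0] := eqVneq x 0; first by rewrite dual0 !normr0 mulr0.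
have nx : 0 < `|x| by rewrite normr_gt0.
rewrite -ler_pdivrMr// mulrC -[X in X * _]ger0_norm ?invr_ge0// -normrM -dualZ.
by rewrite le_opnorm1// normrZ ger0_norm ?invr_ge0// mulVf ?lt0r_neq0.
Qed.

Lemma opnorm_le f (M : R[i]) : 0 <= M -> (forall x, `|f x| <= M * `|x|) ->
  opnorm f <= M.
Proof.
move=> M0 fM; rewrite -(RRe_real (ger0_real M0)) lecR; apply: ge_sup.
  by exists (rnorm (f 0)), 0; rewrite //= normr0.
move=> _ [x /= x1 <-]; rewrite -lecR rnormE RRe_real ?ger0_real//.
by rewrite (le_trans (fM x))// ler_piMr.
Qed.

Lemma opnormD f g : opnorm (f + g) <= opnorm f + opnorm g.
Proof.
apply: opnorm_le => [|x]; first by rewrite addr_ge0// opnorm_ge0.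
by rewrite (le_trans (ler_normD _ _))// mulrDl lerD// le_opnorm.
Qed.

Lemma opnormZ k f : opnorm (k *: f) = `|k| * opnorm f.
Proof.
have leZ (l : R[i]) g : opnorm (l *: g) <= `|l| * opnorm g.
  apply: opnorm_le => [|x]; first by rewrite mulr_ge0// opnorm_ge0.
  by rewrite [leLHS]normrM -mulrA ler_wpM2l// le_opnorm.
have [->|k0] := eqVneq k 0.
  rewrite scale0r normr0 mul0r; apply/le_anti; rewrite opnorm_ge0 andbT.
  by apply: opnorm_le => // x; rewrite normr0 mul0r.
apply/le_anti; rewrite leZ/= -ler_pdivlMl ?normr_gt0// -normfV.
by rewrite -[X in opnorm X <= _](scalerK k0) leZ.
Qed.

Lemma opnorm_eq0 f : opnorm f = 0 -> f = 0.
Proof.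
move=> f0; apply: dualP => x; apply/eqP.
by rewrite -normr_le0 (le_trans (le_opnorm f x))// f0 mul0r.
Qed.

HB.instance Definition _ := Lmodule_isNormed.Build R[i] (dual V)
  opnormD opnormZ opnorm_eq0.

Lemma dual_subproof (f : V -> R[i]) (M : R[i]) : linear f -> 0 <= M ->
  (forall x, `|f x| <= M * `|x|) -> f \in dual_pred V.
Proof.
move=> lf M0 fM; apply/asboolP; split=> //.
pose F := GRing.isLinear.Build R[i] V R[i] *:%R f lf.
pose f' : {linear V -> R[i]} := HB.pack f F.
suff: continuous f' by [].
apply/linear_bounded_continuous/linear_boundedP; near=> r => x.
rewrite (le_trans (fM x))// ler_wpM2r//; near: r; apply: nbhs_pinfty_ge.
by rewrite ger0_real.
Unshelve. all: by end_near. Qed.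
End OperatorNorm.
End Dual.

Arguments dual_pred {R} V.

Notation bidual V := (dual (dual V)).

Section Bidual.
Context {R : realType} (V : normedModType R[i]).

Lemma bidual_emb_subproof (x : V) :
  (fun f : dual V => f x) \in dual_pred (dual V).
Proof.
apply: (@dual_subproof _ _ _ `|x|) => // f.
by rewrite mulrC (le_opnorm f x).
Qed.

Definition bidual_emb (x : V) : bidual V := Dual (bidual_emb_subproof x).

(* Nets are rendered as families indexed by a type with a proper filter (for   *)
(* a net, the filter of its tails).                                            *)
Definition wstar_cvg (T : Type) (E : set_system T) (h : T -> bidual V)
    (F : bidual V) : Prop :=
  forall f : dual V, (fun t => h t f) @ E --> F f.

Definition bounded_net_to (T : Type) (E : set_system T) (u : T -> V)
    (F : bidual V) : Prop :=
  [/\ ProperFilter E, (exists M : R[i], forall t, `|u t| <= M) &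
      wstar_cvg E (bidual_emb \o u) F].

Lemma wstar_cvg_unique (T : Type) (E : set_system T) (h : T -> bidual V) F G :
  ProperFilter E -> wstar_cvg E h F -> wstar_cvg E h G -> F = G.
Proof.
move=> EE hF hG; apply: dualP => f; apply: (@cvg_unique _ _ ((fun t => h t f) @ E)).
- exact: norm_hausdorff.
- exact: hF.
- exact: hG.
Qed.
End Bidual.

Section Arens.
Context {R : realType} (A : banachAlgType R).
Implicit Types (F G H : bidual A) (f : dual A).

(* H = lim_j lim_i u_j v_i with u_j -> F and v_i -> G bounded; K j is the      *)
(* inner limit.                                                                *)
Definition is_arensl F G H : Prop :=
  exists (J I : Type) (EJ : set_system J) (EI : set_system I)
         (u : J -> A) (v : I -> A) (K : J -> bidual A),
    [/\ bounded_net_to EJ u F, bounded_net_to EI v G,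
        forall j, wstar_cvg EI (fun i => bidual_emb (u j ** v i)) (K j) &
        wstar_cvg EJ K H].

(* H = lim_i lim_j u_j v_i *)
Definition is_arensr F G H : Prop :=
  exists (J I : Type) (EJ : set_system J) (EI : set_system I)
         (u : J -> A) (v : I -> A) (K : I -> bidual A),
    [/\ bounded_net_to EJ u F, bounded_net_to EI v G,
        forall i, wstar_cvg EJ (fun j => bidual_emb (u j ** v i)) (K i) &
        wstar_cvg EI K H].

(* is_arensl F G H and is_arensr F G H determine H (lemmas below), and such an *)
(* H exists since every element of the bidual is the limit of a bounded net    *)
(* (Goldstine), so the default value of get plays no role.                     *)
Definition arensl F G : bidual A := get (is_arensl F G).
Definition arensr F G : bidual A := get (is_arensr F G).

Lemma dual_mull_subproof f (a : A) : (fun b => f (a ** b)) \in dual_pred A.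
Proof.
apply: (@dual_subproof _ _ _ (`|f| * `|a|)) => [k x y||x].
- by rewrite bmulDr bmulZr dual_linear.
- by rewrite mulr_ge0.
- by rewrite (le_trans (le_opnorm f _))// -mulrA ler_wpM2l ?opnorm_ge0// bnormM.
Qed.
Definition dual_mull f a : dual A := Dual (dual_mull_subproof f a).

Lemma dual_mulr_subproof f (b : A) : (fun a => f (a ** b)) \in dual_pred A.
Proof.
apply: (@dual_subproof _ _ _ (`|f| * `|b|)) => [k x y||x].
- by rewrite bmulDl bmulZl dual_linear.
- by rewrite mulr_ge0.
- rewrite (le_trans (le_opnorm f _))// -mulrA ler_wpM2l ?opnorm_ge0//.
  by rewrite [leRHS]mulrC bnormM.
Qed.
Definition dual_mulr f b : dual A := Dual (dual_mulr_subproof f b).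

Lemma bidual_actl_subproof G f : (fun a => G (dual_mull f a)) \in dual_pred A.
Proof.
apply: (@dual_subproof _ _ _ (`|G| * `|f|)) => [k x y||x].
- rewrite -dual_linear; congr (G _); apply: dualP => b.
  by rewrite /= bmulDl bmulZl dual_linear.
- by rewrite mulr_ge0.
rewrite (le_trans (le_opnorm G _))// -mulrA ler_wpM2l ?opnorm_ge0//.
apply: opnorm_le => [|b]; first by rewrite mulr_ge0.
by rewrite (le_trans (le_opnorm f _))// -mulrA ler_wpM2l ?opnorm_ge0// bnormM.
Qed.
Definition bidual_actl G f : dual A := Dual (bidual_actl_subproof G f).

Lemma bidual_actr_subproof F f : (fun b => F (dual_mulr f b)) \in dual_pred A.
Proof.
apply: (@dual_subproof _ _ _ (`|F| * `|f|)) => [k x y||x].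
- rewrite -dual_linear; congr (F _); apply: dualP => a.
  by rewrite /= bmulDr bmulZr dual_linear.
- by rewrite mulr_ge0.
rewrite (le_trans (le_opnorm F _))// -mulrA ler_wpM2l ?opnorm_ge0//.
apply: opnorm_le => [|a]; first by rewrite mulr_ge0.
rewrite (le_trans (le_opnorm f _))// -mulrA ler_wpM2l ?opnorm_ge0//.
by rewrite [leRHS]mulrC bnormM.
Qed.
Definition bidual_actr F f : dual A := Dual (bidual_actr_subproof F f).

Lemma is_arenslE F G H f : is_arensl F G H -> H f = F (bidual_actl G f).
Proof.
move=> [J [I [EJ [EI [u [v [K [[EJP _ uF] [EIP _ vG] uvK KH]]]]]]]].
apply: (@cvg_unique _ _ ((fun j => K j f) @ EJ)); [exact: norm_hausdorff| |].
  exact: KH.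
rewrite [X in X @ _](_ : _ = fun j => bidual_emb (u j) (bidual_actl G f)).
  exact: uF.
apply/funext => j /=; apply: (@cvg_unique _ _ ((fun i => f (u j ** v i)) @ EI)).
- exact: norm_hausdorff.
- exact: uvK.
- exact: (vG (dual_mull f (u j))).
Qed.

Lemma is_arensrE F G H f : is_arensr F G H -> H f = G (bidual_actr F f).
Proof.
move=> [J [I [EJ [EI [u [v [K [[EJP _ uF] [EIP _ vG] uvK KH]]]]]]]].
apply: (@cvg_unique _ _ ((fun i => K i f) @ EI)); [exact: norm_hausdorff| |].
  exact: KH.
rewrite [X in X @ _](_ : _ = fun i => bidual_emb (v i) (bidual_actr F f)).
  exact: vG.
apply/funext => i /=; apply: (@cvg_unique _ _ ((fun j => f (u j ** v i)) @ EJ)).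
- exact: norm_hausdorff.
- exact: uvK.
- exact: (uF (dual_mulr f (v i))).
Qed.

Lemma is_arensl_unique F G H H' : is_arensl F G H -> is_arensl F G H' -> H = H'.
Proof.
by move=> /is_arenslE HE /is_arenslE HE'; apply: dualP => f; rewrite HE HE'.
Qed.

Lemma is_arensr_unique F G H H' : is_arensr F G H -> is_arensr F G H' -> H = H'.
Proof.
by move=> /is_arensrE HE /is_arensrE HE'; apply: dualP => f; rewrite HE HE'.
Qed.

Definition arens_regular : Prop := forall F G, arensl F G = arensr F G.
End Arens.

Section BidualStar.
Context {R : realType} (A : banachStarAlgType R).
Implicit Types (F : bidual A) (f : dual A).

Lemma star_bounded :
  exists2 M : R[i], 0 <= M & forall a : A, `|star a| <= M * `|a|.
Proof.
have star0 : star (0 : A) = 0.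
  by rewrite -[X in star X](scale0r 0) starZ rmorph0 scale0r.
have /(@cvgrPdist_lt _ _ _ (nbhs (0 : A))) := @star_continuous R A 0.
move=> /(_ _ ltr01) /nbhs_norm0P[d /= d0 sd].
exists (2 / d) => [|a]; first by rewrite divr_ge0// ltW.
have [->|a0] := eqVneq a 0; first by rewrite star0 !normr0 mulr0.
have na : 0 < `|a| by rewrite normr_gt0.
pose r := d / 2 / `|a|.
have r0 : 0 < r by rewrite !divr_gt0.
have : `|r *: a| < d.
  rewrite normrZ gtr0_norm// divfK ?gt_eqF// ltr_pdivrMr// ltr_pMr//.
  by rewrite ltr1n.
move=> /sd /=; rewrite star0 sub0r normrN starZ normrZ normcJ gtr0_norm//.
rewrite mulrC -ltr_pdivlMr// mul1r => /ltW/le_trans; apply.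
by rewrite /r !invfM !invrK [d^-1 * 2]mulrC.
Qed.

Lemma dual_star_subproof f : (fun a => conjc (f (star a))) \in dual_pred A.
Proof.
have [M M0 sM] := star_bounded.
apply: (@dual_subproof _ _ _ (`|f| * M)) => [k x y||x].
- by rewrite starD starZ dual_linear rmorphD rmorphM/= conjcK.
- by rewrite mulr_ge0.
- by rewrite normcJ (le_trans (le_opnorm f _))// -mulrA ler_wpM2l ?opnorm_ge0//.
Qed.
Definition dual_star f : dual A := Dual (dual_star_subproof f).

Lemma bidual_star_subproof F :
  (fun f => conjc (F (dual_star f))) \in dual_pred (dual A).
Proof.
have [M M0 sM] := star_bounded.
apply: (@dual_subproof _ _ _ (`|F| * M)) => [k f g||f].
- rewrite (_ : dual_star _ = conjc k *: dual_star f + dual_star g); last first.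
    by apply: dualP => a; rewrite /= rmorphD rmorphM.
  by rewrite dual_linear rmorphD rmorphM/= conjcK.
- by rewrite mulr_ge0.
rewrite normcJ (le_trans (le_opnorm F _))// -mulrA ler_wpM2l ?opnorm_ge0//.
apply: opnorm_le => [|a]; first by rewrite mulr_ge0.
by rewrite normcJ (le_trans (le_opnorm f _))// [M * _]mulrC -mulrA ler_wpM2l ?opnorm_ge0//.
Qed.

(* The weak*-continuous extension of the involution of A, see the two lemmas below. *)
Definition bidual_star F : bidual A := Dual (bidual_star_subproof F).

Lemma bidual_star_emb (a : A) :
  bidual_star (bidual_emb a) = bidual_emb (star a).
Proof. by apply: dualP => f; rewrite /= conjcK. Qed.

Lemma bidual_star_wstar_cvg (T : Type) (E : set_system T) (h : T -> bidual A) F :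
  ProperFilter E -> wstar_cvg E h F ->
  wstar_cvg E (bidual_star \o h) (bidual_star F).
Proof.
move=> EE hF f; apply/cvgrPdist_lt => e e0.
have /cvgrPdist_lt/(_ _ e0) := hF (dual_star f).
by apply: filterS => t; rewrite /= -rmorphB normcJ.
Qed.
End BidualStar.

(* The next two notions take the operations as parameters: the bidual of A is  *)
(* a unital Banach *-algebra only when A is Arens-regular.                     *)
Definition jointly_nondegenerate (M : zmodType) (one : M) (mul : M -> M -> M)
    (invol : M -> M) (F G : M) : Prop :=
  exists K, let H := mul (invol F) F + mul (invol G) G in
    mul H K = one /\ mul K H = one.

Definition open_mul_at (R : realType) (M : normedModType R[i])
    (mul : M -> M -> M) (F G : M) : Prop :=
  forall e : R[i], 0 < e -> exists2 d : R[i], 0 < d &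
    ball (mul F G) d `<=` [set mul x y | x in ball F e & y in ball G e].

Definition unital_hom (R : realType) (A B : banachAlgType R) (i : A -> B) :
    Prop :=
  [/\ linear i, forall a b, i (a ** b) = i a ** i b & i (bone A) = bone B].

Definition differential_star_subalgebra (R : realType)
    (A B : banachStarAlgType R) (i : A -> B) : Prop :=
  [/\ unital_hom i, injective i, forall a, i (star a) = star (i a) &
      exists2 D : R[i], 0 < D & forall a b,
        `|a ** b| <= D * (`|a| * `|i b| + `|i a| * `|b|)].

(* Main.v *)
From HB Require Import structures.
Require Import Defs.
From mathcomp Require Import all_boot all_order all_algebra.
From mathcomp Require Import complex ring lra.
From mathcomp Require Import all_classical all_reals topology normedtype.

Set Implicit Arguments.
Unset Strict Implicit.
Unset Printing Implicit Defensive.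
Import Order.TTheory GRing.Theory Num.Theory.
Import numFieldNormedType.Exports.

Local Open Scope classical_set_scope.
Local Open Scope complex_scope.
Local Open Scope ring_scope.
Local Open Scope banach_scope.

(** Why the theorem holds.  The bidual of [A] with the (left) Arens product is
    a unital Banach algebra, and it is commutative: [A] embeds in a function
    algebra, hence is commutative, and for commutative [A] exchanging the two
    arguments turns one Arens product into the other, so that regularity says
    exactly that the product of the bidual is commutative ([arens_mulC]).
    If [H = F^* F + G^* G] has the inverse [K], then [K F^*] and [K G^*] are
    Bezout coefficients for the pair [(F, G)].

    The analytic heart is a fact about every commutative unital Banach algebra
    ([open_mul_of_bezout]).  If [a x + b y = 1], perturbing the two factors
    along the crossed coefficients gives
      [(x + b u) (y + a u) = x y + (a x + b y) u + a b u^2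
                           = x y + u + a b u^2],
    whose linear part in [u] is the identity.  So reaching a point [x y + w]
    near [x y] means solving [u + a b u^2 = w] with [u] small, and for small
    [w] the map [u |-> w - a b u^2] contracts a small ball by the factor 1/2.

    This needs two facts on duals.  The dual of a normed space is complete
    ([dual_complete]), so that contractions of the bidual have fixed points.
    And every element of a bidual is the weak* limit of a bounded net
    ([goldstine]), so that the iterated limits defining the Arens products
    exist and are given by the closed formula [arens_mul].  Goldstine's
    theorem is obtained without separation theorems: given finitely many
    functionals [f] and a point [F] of the bidual, an almost minimizer [x] over
    a ball of [sum_f |F f - f x|^2] satisfies an approximate variational
    inequality, which forces the minimum to be zero ([bidual_approx]). *)

(** * Quadratic equations and open multiplication in Banach algebras *)

Section Contraction.
Context {R : realType}.

Lemma complex_archi (x : R[i]) : 0 <= x ->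
  exists n : nat, x < n%:R.
Proof.
move=> x0; exists (Num.bound (complex.Re x)).
rewrite -[ltLHS](RRe_real (ger0_real x0)) -(rmorph_nat (real_complex R)) ltcR.
by apply: archi_boundP; rewrite -ler0c RRe_real// ger0_real.
Qed.

Lemma geometric_small (c e : R[i]) : 0 <= c -> 0 < e ->
  exists n : nat, c / 2 ^+ n < e.
Proof.
move=> c0 e0; have ce0 : 0 <= c / e by rewrite divr_ge0// ltW.
have [n cn] := complex_archi ce0.
exists n; rewrite ltr_pdivrMr ?exprn_gt0// mulrC -ltr_pdivrMr//.
by rewrite (lt_trans cn)// -natrX ltr_nat ltn_expl.
Qed.

(** The Picard iterates only serve to show that the nested sets [S n] of almost
    fixed points are nonempty.  Two almost fixed points of a contraction are
    close to each other, so these sets generate a Cauchy filter, and its limit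
    is the fixed point. *)
Lemma half_contraction_fixpoint (V : completeNormedModType R[i]) (r : R[i])
    (phi : V -> V) : 0 <= r ->
    (forall u, `|u| <= r -> `|phi u| <= r) ->
    (forall u v, `|u| <= r -> `|v| <= r -> `|phi u - phi v| <= `|u - v| / 2) ->
  exists2 p, `|p| <= r & phi p = p.
Proof.
move=> r0 phir phi2.
pose c n : R[i] := (r + r) / 2 ^+ n.
pose S n := [set u : V | `|u| <= r /\ `|phi u - u| <= c n].
have iterr n : `|iter n phi 0| <= r.
  by elim: n => [|n ih] /=; [rewrite normr0|exact: phir].
have iterS n : S n (iter n phi 0).
  split=> //; elim: n => [|n ih]/=.
    by rewrite /c expr0 divr1 (le_trans (ler_normB _ _))// normr0 lerD// phir// normr0.
  rewrite (le_trans (phi2 _ _ _ _))//; first exact: phir.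
  by rewrite /c exprSr invfM mulrA ler_pM2r ?invr_gt0.
have leS n m : (n <= m)%N -> S m `<=` S n.
  move=> nm u [ur uc]; split=> //; rewrite (le_trans uc)// ler_wpM2l ?addr_ge0//.
  by rewrite lef_pV2 ?posrE ?exprn_gt0// ler_eXn2l// ltr1n.
have diamS n u v : S n u -> S n v -> `|u - v| <= 4 * c n.
  move=> [ur uc] [vr vc].
  have : `|u - v| <= (c n + c n) + `|u - v| / 2.
    have {1}-> : u - v = (phi v - v - (phi u - u)) + (phi u - phi v).
      by rewrite opprB [_ - v + _]addrC addrAC !subrKA.
    rewrite (le_trans (ler_normD _ _))// lerD//; last exact: phi2.
    by rewrite (le_trans (ler_normB _ _))// lerD.
  rewrite {1}(splitr `|u - v|) lerD2r ler_pdivrMr// => /le_trans; apply.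
  by rewrite (_ : _ * 2 = 4 * c n)//; ring.
pose F := filter_from [set: nat] S.
have FF : ProperFilter F.
  apply: filter_from_proper => [|n _]; last by exists (iter n phi 0).
  apply: filter_from_filter => [|n m _ _]; first by exists 0%N.
  by exists (maxn n m) => // u uS; split; apply: leS uS; rewrite ?leq_maxl ?leq_maxr.
have Fc : cauchy F.
  apply/cauchy_ballP => e e0.
  have [|n ne] := @geometric_small (4 * (r + r)) _ _ e0.
    by rewrite mulr_ge0// addr_ge0.
  exists (S n, S n); first by split; exists n.
  move=> [u v] [/= uS vS]; rewrite -ball_normE /= (le_lt_trans (diamS n u v uS vS))//.
  by rewrite /c mulrA.
have /cvg_ex[p Fp0] : cvg F by exact: cauchy_cvg.
have /cvgrPdist_lt Fp : id @ F --> p by exact: Fp0.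
have near e : 0 < e -> exists u, [/\ `|u| <= r, `|phi u - u| < e & `|p - u| < e].
  move=> e0.
  have [|n ne] := @geometric_small (r + r) _ _ e0; first by rewrite addr_ge0.
  have Sn : F (S n) by exists n.
  have [u [[ur uc] pu]] := filter_ex (filterI Sn (Fp _ e0)).
  by exists u; split=> //; exact: le_lt_trans ne.
have pr : `|p| <= r.
  apply/ler_addgt0Pr => e /near[u [ur _ pu]].
  by rewrite -(subrK u p) addrC (le_trans (ler_normD _ _))// lerD// ltW.
exists p => //; apply/eqP; rewrite -subr_eq0 -normr_le0.
apply/ler_addgt0Pr => e e0; rewrite add0r.
have /near[u [ur uc pu]] : 0 < e / 3 by rewrite divr_gt0.
have -> : phi p - p = (phi p - phi u) + ((phi u - u) - (p - u)).
  by rewrite addrA subrKA opprB subrKA.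
have -> : e = e / 3 + (e / 3 + e / 3) by field.
rewrite (le_trans (ler_normD _ _))// lerD//.
  rewrite (le_trans (phi2 _ _ pr ur))// ler_pdivrMr// (le_trans (ltW pu))//.
  by rewrite ler_peMr ?ler1n// divr_ge0// ltW.
by rewrite (le_trans (ler_normB _ _))// lerD// ltW.
Qed.

End Contraction.

Section OpenMul.
Context {R : realType} (B : banachAlgType R).
Implicit Types a b c : B.

Lemma bmulNl a b : (- a) ** b = - (a ** b).
Proof. by rewrite -scaleN1r bmulZl scaleN1r. Qed.

Lemma bmulNr a b : a ** (- b) = - (a ** b).
Proof. by rewrite -scaleN1r bmulZr scaleN1r. Qed.

Lemma bmulBl a b c : (a - b) ** c = a ** c - b ** c.
Proof. by rewrite bmulDl bmulNl. Qed.

Lemma bmulBr a b c : a ** (b - c) = a ** b - a ** c.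
Proof. by rewrite bmulDr bmulNr. Qed.

Context (mulC : commutative (@bmul R B)).

(** On the ball of radius [r], where [u + v] has norm at most [2 r], the map
    [u |-> w - m u^2] satisfies [m v^2 - m u^2 = m (v - u) (v + u)]; so the
    bound [1 / 4] on [|m| r] is what makes it a contraction of factor [1 / 2]
    and leaves [r / 4] of room next to [w]. *)
Lemma small_quadratic_solution (m w : B) (r : R[i]) : 0 <= r ->
    `|m| * r <= 1 / 4 -> `|w| <= r / 2 ->
  exists2 u : B, `|u| <= r & u + m ** (u ** u) = w.
Proof.
move=> r0 mr wr; pose phi u := w - m ** (u ** u).
have [u ur|u v ur vr|u ur up] := half_contraction_fixpoint r0 (phi := phi).
- rewrite /phi (le_trans (ler_normB _ _))// [leRHS]splitr lerD//.
  rewrite (le_trans (bnormM _ _))// (@le_trans _ _ (`|m| * (r * r)))//.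
    by rewrite ler_wpM2l// (le_trans (bnormM _ _))// ler_pM.
  rewrite mulrA (le_trans (ler_wpM2r r0 mr))// mulrC ler_wpM2l//.
  by rewrite ler_pdivrMr// mulrC ler_pdivlMr// mul1r ler_nat.
- have -> : phi u - phi v = m ** ((v - u) ** (v + u)).
    rewrite bmulBl !(bmulDr _ v u) [v ** u]mulC addrKA bmulBr.
    by rewrite /phi opprB addrC addrA subrK.
  rewrite (le_trans (bnormM _ _))// (@le_trans _ _ (`|m| * (`|u - v| * (r + r))))//.
    rewrite ler_wpM2l// (le_trans (bnormM _ _))// distrC ler_wpM2l//.
    by rewrite (le_trans (ler_normD _ _))// lerD.
  rewrite mulrCA ler_wpM2l// mulrDr (le_trans (lerD mr mr))//.
  by rewrite (_ : 1 / 4 + 1 / 4 = 2^-1)//; field.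
by exists u => //; rewrite -{1}up /phi subrK.
Qed.

(** The perturbed factors are [x + b u] and [y + a u], where [u] solves
    [u + a b u^2 = z - x y]. *)
Lemma open_mul_of_bezout (x y a b : B) : a ** x + b ** y = bone B ->
  open_mul_at (@bmul R B) x y.
Proof.
move=> axby e e0; pose C : R[i] := 1 + `|a| + `|b|.
have aC : `|a| <= C by rewrite /C addrAC lerDr addr_ge0.
have bC : `|b| <= C by rewrite /C lerDr addr_ge0.
have C1 : 1 <= C by rewrite /C -addrA lerDl addr_ge0.
have C0 : 0 < C by exact: lt_le_trans C1.
have e1 : 0 < 1 + e by rewrite addr_gt0.
(* This r meets both C r < e, which keeps the factors within e of x and y, *)
(* and C^2 r <= 1/4, which the quadratic equation requires. *)
pose r := e / (4 * C ^+ 2 * (1 + e)).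
have r0 : 0 < r by rewrite divr_gt0// !mulr_gt0// exprn_gt0.
have Cr : C * r < e.
  have -> : C * r = e / (4 * C * (1 + e)) by rewrite /r; field; rewrite !gt_eqF.
  rewrite ltr_pdivrMr ?mulr_gt0// ltr_pMr//.
  rewrite (@lt_le_trans _ _ 4) ?ltr1n// -mulrA ler_peMr// mulr_ege1//.
  by rewrite lerDl ltW.
have abr : `|a ** b| * r <= 1 / 4.
  rewrite (@le_trans _ _ (C ^+ 2 * r))//.
    by rewrite (ler_wpM2r (ltW r0))// (le_trans (bnormM _ _))// expr2 ler_pM.
  have -> : C ^+ 2 * r = (e / (1 + e)) * (1 / 4).
    by rewrite /r; field; rewrite !gt_eqF.
  by rewrite ler_piMl ?divr_ge0// ler_pdivrMr// mul1r lerDr.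
exists (r / 2) => [|z]; first by rewrite divr_gt0.
rewrite -ball_normE /= distrC => zr.
have [u ur uz] := small_quadratic_solution (ltW r0) abr (ltW zr).
have cu c : `|c| <= C -> `|c ** u| < e.
  move=> cC; rewrite (le_lt_trans (bnormM _ _))// (le_lt_trans _ Cr)//.
  by rewrite ler_pM.
exists (x + b ** u).
  by rewrite opprD addrA subrr sub0r normrN cu.
exists (y + a ** u).
  by rewrite opprD addrA subrr sub0r normrN cu.
rewrite -(subrK (x ** y) z) -uz bmulDl !bmulDr.
have -> : b ** u ** (a ** u) = a ** b ** (u ** u).
  by rewrite -bmulA [u ** (a ** u)]mulC -bmulA bmulA [b ** a]mulC.
have -> : x ** (a ** u) = a ** x ** u by rewrite bmulA [x ** a]mulC.
have -> : b ** u ** y = b ** y ** u by rewrite -bmulA [u ** y]mulC bmulA.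
rewrite addrA -[x ** y + _ + b ** y ** u]addrA -bmulDl axby bmul1l.
by rewrite -addrA addrC.
Qed.
End OpenMul.

(** * Completeness of duals *)

Section DualComplete.
Context {R : realType} (V : normedModType R[i]).

(** A Cauchy filter of functionals converges pointwise, and uniformly on balls;
    the limit is bounded because some functional is within distance 1 of it. *)
Lemma dual_complete (F : set_system (dual V)) :
  ProperFilter F -> cauchy F -> cvg F.
Proof.
move=> FF /cauchy_ballP Fc.
have ptc x : cvg ((fun f : dual V => f x) @ F).
  apply/cauchy_cvgP/cauchy_ballP => e e0; rewrite near_map2.
  have e0' : 0 < e / (`|x| + 1) by rewrite divr_gt0// ltr_wpDl// ltr01.
  apply: filterS (Fc _ e0') => -[f g]; rewrite -!ball_normE /ball_/= => fg.
  rewrite (le_lt_trans (le_opnorm (f - g) x))//.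
  rewrite (le_lt_trans (_ : _ <= `|f - g| * (`|x| + 1)))//.
    by rewrite -[opnorm _]/(`|f - g|) ler_wpM2l// lerDl.
  by rewrite -ltr_pdivlMr ?ltr_wpDl.
pose l := fun x => lim ((fun f : dual V => f x) @ F).
have Fl z : (fun f : dual V => f z) @ F --> l z by exact: ptc.
have unif (e : R[i]) : 0 < e ->
    \forall f \near F, forall x, `|l x - (f : dual V) x| <= e * `|x|.
  move=> e0; have /nearP_dep Fe := Fc _ e0.
  apply: filterS Fe => f Ff x; apply/ler_addgt0Pr => d d0.
  have /cvgrPdist_lt/(_ _ d0) Flx := Fl x.
  have [g [/= lg fg]] := filter_ex (filterI Flx Ff).
  rewrite (le_trans (ler_distD (g x) _ _))// addrC.
  apply: lerD; last exact: ltW.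
  rewrite distrC (@le_trans _ _ (`|f - g| * `|x|))//.
    exact: (le_opnorm (f - g) x).
  by rewrite ler_wpM2r// ltW//; move: fg; rewrite -ball_normE.
have ll : linear l.
  move=> k x y /=; apply: (@cvg_unique _ _ ((fun f : dual V => f (k *: x + y)) @ F)).
  - exact: norm_hausdorff.
  - exact: Fl.
  rewrite (_ : (fun f : dual V => _) = fun f => k *: (f x : R[i]) + f y); last first.
    by apply/funext => f; rewrite dual_linear.
  by apply: cvgD; [apply: cvgZr; exact: Fl|exact: Fl].
have [f0 lf0] := filter_ex (unif _ ltr01).
have lb x : `|l x| <= (1 + `|f0|) * `|x|.
  rewrite -(subrK (f0 x) (l x)) (le_trans (ler_normD _ _))// mulrDl lerD//.
  exact: le_opnorm.
have M0 : 0 <= 1 + `|f0| by rewrite addr_ge0.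
apply/cvg_ex; exists (Dual (dual_subproof ll M0 lb)).
apply/cvgrPdist_le => e e0; apply: filterS (unif _ e0) => f fe.
by apply: opnorm_le => //; exact: ltW.
Qed.

HB.instance Definition _ := Uniform_isComplete.Build (dual V) dual_complete.
End DualComplete.

(** * Goldstine's theorem *)

Section Goldstine.
Context {R : realType} (V : normedModType R[i]).
Local Notation Re := complex.Re.
Local Notation Im := complex.Im.

Lemma dualB (f : dual V) x y : f (x - y) = f x - f y.
Proof. by rewrite dualD -scaleN1r dualZ mulN1r. Qed.

(** On the ball of radius [M] the supremum of [Re g] is [M |g|], because every
    value [g z] can be rotated to be real positive; and [|F g| <= M |g|]. *)
Lemma bidual_le_Re (F : bidual V) (g : dual V) (M c : R) : 0 < M ->
    `|F| <= M%:C -> (forall y : V, `|y| <= M%:C -> Re (g y) <= c) ->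
  Re (F g) <= c.
Proof.
move=> M0 FM gc; have M0' : 0 < M%:C by rewrite ltcR.
have c0 : 0 <= c by rewrite -[0]/(Re (0:R[i])) -(dual0 g) gc// normr0 ltW.
have gcM : `|g| <= (c / M)%:C.
  apply: opnorm_le => [|z]; first by rewrite ler0c divr_ge0// ltW.
  have [->|z0] := eqVneq z 0; first by rewrite dual0 !normr0 mulr0.
  have [->|gz0] := eqVneq (g z) 0.
    by rewrite normr0 mulr_ge0// ler0c divr_ge0// ltW.
  (* k z has norm M, and its phase makes g (k z) real and positive. *)
  pose k : R[i] := (M%:C / `|z|) * (conjc (g z) / `|g z|).
  have nk : `|k *: z| <= M%:C.
    rewrite normrZ !normrM normcJ !normfV !normr_id mulfV ?normr_eq0// mulr1.
    by rewrite divfK ?normr_eq0// gtr0_norm.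
  have gck : (Re (g (k *: z)))%:C <= c%:C by rewrite lecR gc.
  have kgz : g (k *: z) = M%:C * `|g z| / `|z|.
    rewrite dualZ /k -[LHS]mulrA [conjc _ / _ * _]mulrAC [conjc _ * _]mulrC -sqr_normc.
    by rewrite expr2 mulfK ?normr_eq0// mulrAC.
  move: gck; rewrite kgz RRe_real; last first.
    by rewrite ger0_real// divr_ge0// mulr_ge0// ltW.
  rewrite ler_pdivrMr ?normr_gt0// mulrC -ler_pdivlMr// mulrAC.
  by rewrite -rmorphV ?unitfE ?gt_eqF// -rmorphM.
have Fgc : `|F g| <= c%:C.
  rewrite (le_trans (le_opnorm F g))// (le_trans (ler_pM _ _ FM gcM))//.
  by rewrite -rmorphM/= mulrC divfK// gt_eqF.
rewrite -lecR (le_trans _ (le_trans (normc_ge_Re _) Fgc))//.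
by rewrite lecR ler_norm.
Qed.

(** The squared modulus with real values, so that ordered-field reasoning about
    sums of squares takes place in [R] rather than in [R[i]]. *)
Definition sqn (z : R[i]) : R := Re z ^+ 2 + Im z ^+ 2.

Lemma sqn_ge0 z : 0 <= sqn z.
Proof. by rewrite addr_ge0// sqr_ge0. Qed.

Lemma sqnE z : (sqn z)%:C = `|z| ^+ 2.
Proof. exact: add_Re2_Im2. Qed.

Lemma sqnJ w : sqn w = Re (conjc w * w).
Proof. by case: w => a b; rewrite /sqn /=; ring. Qed.

Lemma sqnB w (t : R) z : sqn (w - t%:C * z) =
  sqn w - 2 * t * Re (conjc w * z) + t ^+ 2 * sqn z.
Proof. by case: w z => [a b] [c d]; rewrite /sqn /=; ring. Qed.

Lemma ReD : {morph (@complex.Re R) : x y / x + y}.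
Proof. by move=> [a b] [c d]. Qed.

Lemma ReB : {morph (@complex.Re R) : x y / x - y}.
Proof. by move=> [a b] [c d]. Qed.

(** Let [x] minimize [d x = sum_f |F f - f x|^2] over the ball up to [t^2], and
    let [w f = F f - f x].  Moving from [x] towards a point [y] of the ball by
    the fraction [t] cannot decrease [d] by more than [t^2], so the functional
    [g = sum_f (w f)^* f] satisfies [Re (g y) <= Re (g x) + O(t)].  Then
    [Re (F g) <= Re (g x) + O(t)] as well, while
    [Re (F g) - Re (g x) = sum_f |w f|^2 = d x]; so [d x] is [O(t)]. *)
Lemma bidual_approx (F : bidual V) (s : seq (dual V)) (e : R[i]) : 0 < e ->
  exists2 x : V, `|x| <= `|F| + 1 & forall f, f \in s -> `|F f - f x| < e.
Proof.
move=> /[dup] /gtr0_real/RRe_real <-; move: (Re e) => {e} r; rewrite ltcR => r0.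
have e0 : 0 < r ^+ 2 by rewrite exprn_gt0.
pose e := r ^+ 2; rewrite -/e in e0.
pose M := rnorm F + 1.
have MC : M%:C = `|F| + 1 by rewrite rmorphD/= rnormE.
have M0 : 0 < M by rewrite -ltcR MC ltr_wpDl.
have FM : `|F| <= M%:C by rewrite MC lerDl.
pose d x : R := \sum_(f <- s) sqn (F f - (f : dual V) x).
(* C bounds the quadratic term: two points of the ball are at distance at *)
(* most 2 M.  The +1 in M keeps the radius positive when F = 0. *)
pose C : R := \sum_(f <- s) (rnorm f * (2 * M)) ^+ 2.
have C0 : 0 <= C by apply: sumr_ge0 => f _; exact: sqr_ge0.
have D0 : 0 < e + 1 + C by lra.
(* Any t in ]0, 1] with t (1 + C) / 2 < e would do. *)
pose t := e / (e + 1 + C).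
have t0 : 0 < t by rewrite divr_gt0.
have t1 : t <= 1 by rewrite ler_pdivrMr// mul1r; lra.
have tC : t * (1 + C) / 2 < e.
  by rewrite ltr_pdivrMr// /t mulrAC ltr_pdivrMr// -mulrA ltr_pM2l//; lra.
pose B := [set x : V | `|x| <= M%:C].
have Einf : has_inf (d @` B).
  split; first by exists (d 0), 0 => //; rewrite /B /= normr0 ler0c ltW.
  by exists 0 => _ [x _ <-]; apply: sumr_ge0 => f _; exact: sqn_ge0.
have t20 : 0 < t ^+ 2 by rewrite exprn_gt0.
have [_ [x Bx <-] dx] := inf_adherent t20 Einf.
pose w (f : dual V) := F f - f x.
pose g : dual V := \sum_(f <- s) conjc (w f) *: f.
have gE z : Re (g z) = \sum_(f <- s) Re (conjc (w f) * f z).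
  rewrite /g (@big_morph _ _ (fun h : dual V => h z) 0 +%R 0 +%R)//.
  by rewrite (big_morph _ ReD (erefl _)).
have FgE : Re (F g) = \sum_(f <- s) Re (conjc (w f) * F f).
  rewrite /g (big_morph F (dualD F) (dual0 F)) (big_morph _ ReD (erefl _)).
  by apply: eq_bigr => f _; rewrite dualZ.
have Fg : Re (F g) <= Re (g x) + t * (1 + C) / 2.
  apply: (bidual_le_Re M0 FM) => y By.
  pose z := y - x; pose Q := \sum_(f <- s) sqn (f z).
  have QC : Q <= C.
    apply: ler_sum => f _; rewrite -lecR sqnE rmorphXn/= ler_sqr ?nnegrE//.
    rewrite (le_trans (le_opnorm f z))// rmorphM/= rnormE ler_wpM2l ?opnorm_ge0//.
      by rewrite /z (le_trans (ler_normB _ _))// mulrDl mul1r rmorphD lerD.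
    by rewrite ler0c !mulr_ge0 ?(ltW M0)// -ler0c rnormE.
  have Bxt : B (x + t%:C *: z).
    have -> : x + t%:C *: z = (1 - t)%:C *: x + t%:C *: y.
      by rewrite rmorphB/= scalerBl scale1r scalerBr addrA [x - _ + _]addrAC.
    rewrite /B/= (le_trans (ler_normD _ _))// !normrZ.
    rewrite !ger0_norm ?ler0c ?subr_ge0// ?(ltW t0)//.
    rewrite (_ : M%:C = (1 - t)%:C * M%:C + t%:C * M%:C); last first.
      by rewrite -mulrDl -rmorphD subrK mul1r.
    by rewrite lerD// ler_wpM2l// ler0c ?subr_ge0// (ltW t0).
  have := ge_inf Einf.2 (imageP d Bxt).
  have -> : d (x + t%:C *: z) = d x - 2 * t * Re (g z) + t ^+ 2 * Q.
    rewrite gE !mulr_sumr -sumrB -big_split; apply: eq_bigr => f _ /=.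
    by rewrite -sqnB /w dualD dualZ opprD addrA.
  move=> dxt.
  have : t * (2 * Re (g z)) <= t * (t * (1 + C)) by nra.
  by rewrite ler_pM2l// {1}/z dualB ReB; lra.
have dxE : d x = Re (F g) - Re (g x).
  rewrite FgE gE -sumrB; apply: eq_bigr => f _.
  by rewrite sqnJ -/(w f) [X in _ * X]/w mulrBr ReB.
exists x => [|f fs]; first by rewrite -MC.
rewrite -ltr_sqr ?nnegrE// ?ler0c ?(ltW r0)// -sqnE -rmorphXn/= ltcR.
rewrite (@le_lt_trans _ _ (d x))//; last by rewrite -/e; lra.
by rewrite /d (big_rem f)//= lerDl sumr_ge0// => h _; exact: sqn_ge0.
Qed.
End Goldstine.

(** The net is indexed by the finite sequences of functionals.  A sequence of
    length [n] asks for an approximation within [1 / (n + 1)] on each of its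
    entries, so repeating one functional many times forces precision on it;
    this is why the tails also compare lengths. *)
Lemma goldstine (R : realType) (V : normedModType R[i]) (F : bidual V) :
  exists (T : Type) (E : set_system T) (u : T -> V), bounded_net_to E u F.
Proof.
have H (s : seq (dual V)) : exists x : V, `|x| <= `|F| + 1 /\
    forall f, f \in s -> `|F f - f x| < (size s).+1%:R^-1.
  have e0 : 0 < (size s).+1%:R^-1 :> R[i] by rewrite invr_gt0.
  by have [x xM xs] := bidual_approx F s e0; exists x.
have [u uP] := choice H.
pose S (s : seq (dual V)) :=
  [set s' : seq (dual V) | {subset s <= s'} /\ (size s <= size s')%N].
have SF : ProperFilter (filter_from setT S).
  apply: filter_from_proper => [|s _]; last by exists s; split=> // f.
  apply: filter_from_filter => [|s1 s2 _ _]; first by exists [::].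
  exists (s1 ++ s2) => // s [ss]; rewrite size_cat => sz; split; split.
  + by move=> f fs; apply: ss; rewrite mem_cat fs.
  + exact: leq_trans (leq_addr _ _) sz.
  + by move=> f fs; apply: ss; rewrite mem_cat fs orbT.
  + exact: leq_trans (leq_addl _ _) sz.
exists (seq (dual V)), (filter_from setT S), u; split=> //.
- by exists (`|F| + 1) => s; have [] := uP s.
move=> f; apply/cvgrPdist_lt => e e0.
have [|n ne] := @complex_archi _ e^-1; first by rewrite invr_ge0 ltW.
exists (nseq n.+1 f) => // s [fs]; rewrite size_nseq => ns /=.
have /(uP s).2 : f \in s by apply: fs; rewrite inE eqxx.
move=> /lt_trans; apply.
rewrite -[ltRHS]invrK ltf_pV2 ?posrE ?invr_gt0// (lt_le_trans ne)// ler_nat.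
by rewrite (leq_trans (leqnSn n))// (leq_trans ns).
Qed.

(** * The bidual as a Banach algebra *)

Section ArensProduct.
Context {R : realType} {A : banachAlgType R}.
Implicit Types F G H : bidual A.

Lemma bidual_actl_norm G (f : dual A) : `|bidual_actl G f| <= `|G| * `|f|.
Proof.
apply: opnorm_le => [|a]; first by rewrite mulr_ge0.
rewrite (le_trans (le_opnorm G _))// -mulrA ler_wpM2l ?opnorm_ge0//.
apply: opnorm_le => [|b]; first by rewrite mulr_ge0.
by rewrite (le_trans (le_opnorm f _))// -mulrA ler_wpM2l ?opnorm_ge0// bnormM.
Qed.

Lemma arens_mul_subproof F G :
  (fun f => F (bidual_actl G f)) \in dual_pred (dual A).
Proof.
apply: (@dual_subproof _ _ _ (`|F| * `|G|)) => [k f g||f].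
- rewrite -dual_linear; congr (F _); apply: dualP => a /=.
  transitivity (G (k *: dual_mull f a + dual_mull g a)); last exact: dual_linear.
  by congr (G _); apply: dualP.
- by rewrite mulr_ge0.
rewrite (le_trans (le_opnorm F _))// -mulrA ler_wpM2l ?opnorm_ge0//.
exact: bidual_actl_norm.
Qed.
(** The closed formula [f |-> F (a |-> G (b |-> f (a b)))] for the left Arens
    product, from which the algebra axioms can be read off. *)
Definition arens_mul F G : bidual A := Dual (arens_mul_subproof F G).

(** The inner limits of the iterated limit are the products of the points
    [u j] of [A] with [G]. *)
Lemma is_arensl_mul F G : is_arensl F G (arens_mul F G).
Proof.
have [J [EJ [u uF]]] := goldstine F; have [I [EI [v vG]]] := goldstine G.
exists J, I, EJ, EI, u, v, (fun j => arens_mul (bidual_emb (u j)) G).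
split=> // [j f|f].
- by case: vG => _ _ /(_ (dual_mull f (u j))).
- by case: uF => _ _ /(_ (bidual_actl G f)).
Qed.

Lemma arenslE F G : arensl F G = arens_mul F G.
Proof.
apply: is_arensl_unique (is_arensl_mul F G).
exact: getI (is_arensl_mul F G).
Qed.

(** In a commutative algebra the right product of [F] and [G] is the left
    product of [G] and [F]: both take the limit along [F] first. *)
Lemma is_arensr_mul F G (mulC : commutative (@bmul R A)) :
  is_arensr F G (arens_mul G F).
Proof.
have [J [EJ [u uF]]] := goldstine F; have [I [EI [v vG]]] := goldstine G.
exists J, I, EJ, EI, u, v, (fun i => arens_mul (bidual_emb (v i)) F).
split=> // [i f|f].
- case: uF => _ _ /(_ (dual_mull f (v i))) /=.
  by under eq_fun do rewrite mulC.
- by case: vG => _ _ /(_ (bidual_actl F f)).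
Qed.

Lemma arens_mulC : commutative (@bmul R A) -> arens_regular A ->
  commutative arens_mul.
Proof.
move=> mulC reg F G; rewrite -arenslE reg.
apply: is_arensr_unique (is_arensr_mul F G mulC).
exact: getI (is_arensr_mul F G mulC).
Qed.

Let mulA : associative arens_mul.
Proof.
move=> F G H; apply: dualP => f /=; congr (F _); apply: dualP => a /=.
congr (G _); apply: dualP => b /=; congr (H _); apply: dualP => c /=.
by rewrite bmulA.
Qed.
Let mul1 : left_id (bidual_emb (bone A)) arens_mul.
Proof.
by move=> G; apply: dualP => f; congr (G _); apply: dualP => b /=; rewrite bmul1l.
Qed.
Let mulr1 : right_id (bidual_emb (bone A)) arens_mul.
Proof.
by move=> G; apply: dualP => f; congr (G _); apply: dualP => b /=; rewrite bmul1r.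
Qed.
Let mulDl : left_distributive arens_mul +%R.
Proof. by move=> F G H; apply: dualP. Qed.
Let mulDr : right_distributive arens_mul +%R.
Proof.
move=> F G H; apply: dualP => f; transitivity (F (bidual_actl G f + bidual_actl H f)).
  by congr (F _); apply: dualP.
exact: dualD.
Qed.
Let mulZl (k : R[i]) F G : arens_mul (k *: F) G = k *: arens_mul F G.
Proof. exact: dualP. Qed.
Let mulZr (k : R[i]) F G : arens_mul F (k *: G) = k *: arens_mul F G.
Proof.
apply: dualP => f; transitivity (F (k *: bidual_actl G f)).
  by congr (F _); apply: dualP.
exact: dualZ.
Qed.
Let normM F G : `|arens_mul F G| <= `|F| * `|G|.
Proof.
apply: opnorm_le => [|f]; first by rewrite mulr_ge0.
rewrite (le_trans (le_opnorm F _))// -mulrA ler_wpM2l ?opnorm_ge0//.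
exact: bidual_actl_norm.
Qed.

HB.instance Definition _ := isBanachAlgebra.Build R (bidual A)
  mulA mul1 mulr1 mulDl mulDr mulZl mulZr normM.
End ArensProduct.

Theorem corollary1p2 (R : realType) (A : banachStarAlgType R)
    (X : topologicalType) (Xcompact : compact [set: X])
    (Xhausdorff : hausdorff_space X) (i : A -> contfun R Xcompact)
    (Aregular : arens_regular A)
    (idiff : differential_star_subalgebra i) (idense : dense (range i)) :
  forall F G : bidual A,
    jointly_nondegenerate (bidual_emb (bone A)) (@arensl R A) (@bidual_star R A)
      F G ->
    open_mul_at (@arensl R A) F G.
Proof.
have mulC : commutative (@bmul R A).
  case: idiff => [[_ iM _] iinj _ _] a b; apply: iinj; rewrite !iM.
  by apply: contfunP => x; exact: mulrC.
have arensE : @arensl R A = @bmul R (bidual A).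
  by apply/funext => F; apply/funext => G; exact: arenslE.
rewrite arensE => F G [K [HK _]].
have mulbC : commutative (@bmul R (bidual A)) by exact: arens_mulC.
apply: (open_mul_of_bezout mulbC (a := K ** bidual_star F)
  (b := K ** bidual_star G)).
by rewrite -!bmulA -bmulDr mulbC.
Qed.
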